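(* Let $f_1:S_1\to O$ and $f_2:S_2\to O$ be regular fibrations over a common base $O$, with regular lifting functions $L_{f_1}, L_{f_2}$, having a common fiber space $F_{r_o}=f_1^{-1}(r_o)=f_2^{-1}(r_o)$ over $r_o\in O$, and let $s_o\in F_{r_o}$. Suppose the $Lf$-functions of $f_1$ and $f_2$ are conjugate by a homeomorphism $g:F_{r_o}\to F_{r_o}$, i.e. $\Theta_{L_{f_1}}\simeq g'\circ\Theta_{L_{f_2}}\circ(\mathrm{id}_{\Omega(O,r_o)}\times g)$ where $g'$ is a homotopy inverse of $g$, and suppose $F_{r_o}$ is a pathwise connected ANR. If $S_1$ and $S_2$ are simply connected and $\Omega(O,r_o)$ has the homotopy type of an ANR, then the fibrations $[\Sigma(f_1)]_{g\times g}$ and $\Sigma(f_2)$ over $F_{r_o}\times F_{r_o}$ are fiber homotopy equivalent.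
   Context: All spaces are Hausdorff; $I=[0,1]$, $S^I$ is the space of paths in $S$ with the compact-open topology, $\widetilde{s}$ is the constant path at $s$, $\Omega(O,r_o)\subset O^I$ is the space of loops at $r_o$, and $\simeq$ denotes homotopy of maps. ANR means absolute neighborhood retract. ''Fibration'' means Hurewicz fibration. For a fibration $f:S\to O$ let $\bigtriangleup f=\{(s,\alpha)\in S\times O^I: f(s)=\alpha(0)\}$. A lifting function for $f$ is a continuous map $L_f:\bigtriangleup f\to S^I$ with $L_f(s,\alpha)(0)=s$ and $f\circ L_f(s,\alpha)=\alpha$; it is regular if $L_f(s,f\circ\widetilde{s})=\widetilde{s}$ for all $s\in S$. A fibration is regular if it has a regular lifting function. For $F_{r_o}=f^{-1}(r_o)$, the $Lf$-function of $f$ induced by $L_f$ is $\Theta_{L_f}:\Omega(O,r_o)\times F_{r_o}\to F_{r_o}$, $\Theta_{L_f}(\alpha,s)=L_f(s,\alpha)(1)$. For a subspace $F\subset S$, $\Sigma(S,F)=\{\alpha\in S^I:\alpha(0)\in F,\ \alpha(1)\in F\}$. For a fibration $f:S\to O$ with fiber $F_{r_o}$, $\Sigma(f)$ denotes the fibration $\Phi:\Sigma(S,F_{r_o})\to F_{r_o}\times F_{r_o}$, $\Phi(\alpha)=(\alpha(0),\alpha(1))$. For a fibration $p:E\to B$ and a homeomorphism $u$ of $B$ onto a space $B'$, $[p]_u$ denotes the fibration $u\circ p:E\to B'$; thus $[\Sigma(f_1)]_{g\times g}$ is $(g\times g)\circ\Phi_1$, where $\Phi_1$ is the fibration $\Sigma(f_1)$.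 Two fibrations $p_1:E_1\to B$, $p_2:E_2\to B$ are fiber homotopy equivalent if there are maps $u:E_1\to E_2$, $v:E_2\to E_1$ over $\mathrm{id}_B$ such that $v\circ u$ and $u\circ v$ are homotopic to the identities through maps over $\mathrm{id}_B$. *)

(* Defs.v *)
From HB Require Import structures.
From mathcomp Require Import all_boot all_order all_algebra.
From mathcomp Require Import all_classical all_reals all_analysis.

Set Implicit Arguments.
Unset Strict Implicit.
Unset Printing Implicit Defensive.

Import Order.TTheory GRing.Theory Num.Theory.
Import numFieldTopology.Exports.

(* [continuousType X Y] carries the compact-open topology. *)
Export ArrowAsCompactOpen.

Local Open Scope classical_set_scope.
Local Open Scope ring_scope.

Notation unit_interval R := (set_type (`[0%R, 1%R]%classic : set R)).

Section Interval.
Variable R : realType.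

Lemma zero_in_unit : (0 : R) \in (`[0%R, 1%R]%classic : set R).
Proof. by rewrite inE /= in_itv /= lexx ler01. Qed.

Lemma one_in_unit : (1 : R) \in (`[0%R, 1%R]%classic : set R).
Proof. by rewrite inE /= in_itv /= lexx ler01. Qed.

Definition I0 : unit_interval R := exist _ 0 zero_in_unit.
Definition I1 : unit_interval R := exist _ 1 one_in_unit.

End Interval.

Arguments I0 {R}.
Arguments I1 {R}.

Notation pathspace R S := (continuousType (unit_interval R) S).

Definition const_path (R : realType) (S : topologicalType) (s : S) :
  pathspace R S := cst s.

Definition map_path (R : realType) (S O : topologicalType)
  (f : continuousType S O) (a : pathspace R S) : pathspace R O := f \o a.

Definition sub_elt (T : Type) (A : set T) (x : T) (Ax : A x) : set_type A :=
  exist (fun y => is_true (y \in A)) x (mem_set Ax).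

Section Homotopy.
Variable R : realType.
Implicit Types X Y : topologicalType.

Definition homotopic X Y (f g : X -> Y) : Prop :=
  exists H : X * unit_interval R -> Y,
    [/\ continuous H, forall x, H (x, I0) = f x & forall x, H (x, I1) = g x].

Definition homotopy_inverse X Y (f : X -> Y) (f' : Y -> X) : Prop :=
  [/\ continuous f, continuous f',
      homotopic (f' \o f) idfun & homotopic (f \o f') idfun].

Definition homotopy_equivalent X Y : Prop :=
  exists (f : X -> Y) (f' : Y -> X), homotopy_inverse f f'.

Definition path_connected X : Prop :=
  forall x y : X, exists a : pathspace R X, a I0 = x /\ a I1 = y.

Definition simply_connected X : Prop :=
  path_connected X /\
  forall a : pathspace R X, a I0 = a I1 ->
    exists H : unit_interval R * unit_interval R -> X,
      [/\ continuous H, forall s, H (s, I0) = a s,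
          forall s, H (s, I1) = a I0 &
          forall t, H (I0, t) = a I0 /\ H (I1, t) = a I0].

End Homotopy.

Record homeomorphism (X Y : topologicalType) := Homeomorphism {
  homeo_fun :> X -> Y;
  homeo_inv : Y -> X;
  homeo_fun_continuous : continuous homeo_fun;
  homeo_inv_continuous : continuous homeo_inv;
  homeo_funK : cancel homeo_fun homeo_inv;
  homeo_invK : cancel homeo_inv homeo_fun
}.

Definition homeo_sym (X Y : topologicalType) (u : homeomorphism X Y) :
  homeomorphism Y X :=
  Homeomorphism (@homeo_inv_continuous _ _ u) (@homeo_fun_continuous _ _ u)
    (@homeo_invK _ _ u) (@homeo_funK _ _ u).

Definition prod_map (X Y X' Y' : Type) (u : X -> X') (v : Y -> Y')
  (z : X * Y) : X' * Y' := (u z.1, v z.2).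

Lemma prod_map_continuous (X Y X' Y' : topologicalType)
  (u : X -> X') (v : Y -> Y') :
  continuous u -> continuous v -> continuous (prod_map u v).
Proof.
move=> cu cv [x y]; apply: (cvg_pair (f := fun z => u z.1) (g := fun z => v z.2)).
  by apply: continuous_comp; [exact: cvg_fst|exact: cu].
by apply: continuous_comp; [exact: cvg_snd|exact: cv].
Qed.

Lemma prod_map_cancel (X Y X' Y' : Type) (u : X -> X') (v : Y -> Y')
  (u' : X' -> X) (v' : Y' -> Y) :
  cancel u u' -> cancel v v' -> cancel (prod_map u v) (prod_map u' v').
Proof. by move=> uK vK [x y]; rewrite /prod_map /= uK vK. Qed.

Definition homeo_prod (X Y X' Y' : topologicalType)
  (u : homeomorphism X X') (v : homeomorphism Y Y') :
  homeomorphism (X * Y)%type (X' * Y')%type :=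
  Homeomorphism
    (prod_map_continuous (@homeo_fun_continuous _ _ u)
       (@homeo_fun_continuous _ _ v))
    (prod_map_continuous (@homeo_inv_continuous _ _ u)
       (@homeo_inv_continuous _ _ v))
    (prod_map_cancel (@homeo_funK _ _ u) (@homeo_funK _ _ v))
    (prod_map_cancel (@homeo_invK _ _ u) (@homeo_invK _ _ v)).

Section ANR.
Variable R : realType.

Definition metrizable (X : topologicalType) : Prop :=
  exists M : metricType R, inhabited (homeomorphism X M).

Definition closed_embedding (X Y : topologicalType) (e : X -> Y) : Prop :=
  [/\ injective e, continuous e &
      forall A : set X, closed A -> closed (e @` A)].

(* Absolute neighborhood retract for the class of metrizable spaces. *)
Definition is_ANR (X : topologicalType) : Prop :=
  metrizable X /\
  forall (Y : topologicalType) (e : X -> Y),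
    metrizable Y -> closed_embedding e ->
    exists (U : set Y) (r : set_type U -> X),
      [/\ open U, range e `<=` U, continuous r &
          forall (x : X) (u : set_type U), set_val u = e x -> r u = x].

Definition has_ANR_homotopy_type (X : topologicalType) : Prop :=
  exists2 Y : topologicalType, is_ANR Y & homotopy_equivalent R X Y.

End ANR.

Section Fibrations.
Variable R : realType.
Local Notation I := (unit_interval R).

Definition hurewicz_fibration (E B : topologicalType) (p : E -> B) : Prop :=
  continuous p /\
  forall (X : topologicalType) (h : X -> E) (H : X * I -> B),
    hausdorff_space X -> continuous h -> continuous H ->
    (forall x, H (x, I0) = p (h x)) ->
    exists K : X * I -> E,
      [/\ continuous K, forall x, K (x, I0) = h x & forall z, p (K z) = H z].

Definition fiber_homotopic (E B : topologicalType) (p : E -> B)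
    (f g : E -> E) : Prop :=
  exists H : E * I -> E,
    [/\ continuous H, forall x, H (x, I0) = f x, forall x, H (x, I1) = g x &
        forall x t, p (H (x, t)) = p x].

Definition fiber_homotopy_equivalent (E1 E2 B : topologicalType)
    (p1 : E1 -> B) (p2 : E2 -> B) : Prop :=
  exists (u : E1 -> E2) (v : E2 -> E1),
    [/\ continuous u /\ continuous v,
        forall x, p2 (u x) = p1 x,
        forall y, p1 (v y) = p2 y,
        fiber_homotopic p1 (v \o u) idfun &
        fiber_homotopic p2 (u \o v) idfun].

(* [p]_u *)
Definition rebase (E B B' : topologicalType) (p : E -> B)
  (u : homeomorphism B B') : E -> B' := u \o p.

Definition fiber (S O : topologicalType) (f : S -> O) (o : O) : set S :=
  f @^-1` [set o].

Definition loops (O : topologicalType) (o : O) : set (pathspace R O) :=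
  [set a : pathspace R O | a I0 = o /\ a I1 = o].

Section Lifting.
Variables (S O : topologicalType) (f : continuousType S O).

Definition triangle : set (S * pathspace R O) := 
  [set z : S * pathspace R O | f z.1 = z.2 I0].

Definition mk_triangle (s : S) (a : pathspace R O) (e : f s = a I0) :
  set_type triangle := @sub_elt _ triangle (s, a) e.

Record lifting_function := LiftingFunction {
  lift_fun :> set_type triangle -> pathspace R S;
  lift_continuous : continuous lift_fun;
  lift_start : forall z, lift_fun z I0 = (set_val z).1;
  lift_over : forall z, map_path f (lift_fun z) = (set_val z).2
}.

Definition regular_lifting_function (L : lifting_function) : Prop :=
  forall s : S,
    L (@mk_triangle s (map_path f (const_path R s)) erefl) = const_path R s.

Definition regular_fibration : Prop :=
  hurewicz_fibration f /\ exists L, regular_lifting_function L.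

Variable o : O.

Lemma loop_triangle (a : set_type (loops o)) (s : set_type (fiber f o)) :
  f (set_val s) = (set_val a : pathspace R O) I0.
Proof. by have /= [-> _] := set_valP a; exact: (set_valP s). Qed.

Lemma lift_loop_fiber (L : lifting_function) (a : set_type (loops o))
  (s : set_type (fiber f o)) :
  fiber f o (L (mk_triangle (loop_triangle a s)) I1).
Proof.
set z := mk_triangle _.
rewrite /fiber /= -[LHS]/(map_path f (L z) I1) lift_over /=.
by have /= [] := set_valP a.
Qed.

(* Theta_L(a, s) = L(s, a)(1) *)
Definition Lf_function (L : lifting_function)
  (z : set_type (loops o) * set_type (fiber f o)) : set_type (fiber f o) :=
  sub_elt (lift_loop_fiber L z.1 z.2).

End Lifting.

Section PathsWithEndsInSubspace.
Variables (S : topologicalType) (A : set S).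

Definition Sigma_space : set (pathspace R S) :=
  [set a : pathspace R S | A (a I0) /\ A (a I1)].

Definition Sigma_proj (a : set_type Sigma_space) : set_type A * set_type A :=
  (sub_elt (proj1 (set_valP a)), sub_elt (proj2 (set_valP a))).

End PathsWithEndsInSubspace.

Definition Sigma_fib (S O : topologicalType) (f : S -> O) (o : O) :=
  @Sigma_proj S (fiber f o).

(* Fibrations in different types S1, S2 cannot literally share a fiber; instead
   a space F is identified with each fiber f^-1(o) by a homeomorphism j, and
   Lf_function_on, Sigma_fib_on are Theta_L and Sigma(f) transported to F. *)

Definition Lf_function_on (S O : topologicalType) (f : continuousType S O)
    (o : O) (F : topologicalType) (j : homeomorphism F (set_type (fiber f o)))
    (L : lifting_function f) (z : set_type (loops o) * F) : F :=
  homeo_inv j (Lf_function L (z.1, j z.2)).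

Definition Sigma_fib_on (S O : topologicalType) (f : S -> O)
    (o : O) (F : topologicalType) (j : homeomorphism F (set_type (fiber f o))) :
  set_type (Sigma_space (fiber f o)) -> F * F :=
  rebase (@Sigma_fib S O f o) (homeo_prod (homeo_sym j) (homeo_sym j)).

End Fibrations.

Arguments loops R {O} o.
Arguments Sigma_fib_on R {S O f o F} j.

(* Main.v *)
(* Write Theta for the Lf-function and Sigma for the total space of Sigma(f).
   The maps [push : (w, x) |-> L(x, w)] and [pull : a |-> (f o a, a(0))] are
   inverse homotopy equivalences between Omega(O, ro) x F and Sigma, and
   Sigma(f) o push = (x, Theta(w, x)).  Hence push2 o (id x g) o pull1 is a
   homotopy equivalence Sigma1 -> Sigma2, and conjugacy of the Lf-functions says
   exactly that it covers the identity of F x F up to homotopy.  Since both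
   projections have the homotopy lifting property, Dold's theorem turns it into
   a fiber homotopy equivalence. *)
From HB Require Import structures.
Require Import Defs.
From mathcomp Require Import all_boot all_order all_algebra.
From mathcomp Require Import all_classical all_reals all_analysis.
From mathcomp Require Import lra.

Set Implicit Arguments.
Unset Strict Implicit.
Unset Printing Implicit Defensive.

Import Order.TTheory GRing.Theory Num.Theory.
Import numFieldTopology.Exports numFieldNormedType.Exports.

Local Open Scope classical_set_scope.
Local Open Scope ring_scope.

(** * Closure properties of continuous maps, with the pasting lemma *)

Section Continuity.
Implicit Types X Y Z : topologicalType.

Lemma continuous_compT X Y Z (g : Y -> Z) (f : X -> Y) :
  continuous g -> continuous f -> continuous (fun x => g (f x)).
Proof. by move=> cg cf x; apply: continuous_comp; [exact: cf|exact: cg]. Qed.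

Lemma continuous_pairT X Y Z (f : X -> Y) (g : X -> Z) :
  continuous f -> continuous g -> continuous (fun x => (f x, g x)).
Proof. by move=> cf cg x; apply: cvg_pair; [exact: cf|exact: cg]. Qed.

Lemma continuous_idT X : continuous (fun x : X => x).
Proof. by move=> x; exact: cvg_id. Qed.

Lemma continuous_cstT X Y (y : Y) : continuous (fun _ : X => y).
Proof. by move=> x; exact: cvg_cst. Qed.

Lemma continuous_fstT X Y Z (f : X -> Y * Z) :
  continuous f -> continuous (fun x => (f x).1).
Proof. by apply: continuous_compT => x; exact: cvg_fst. Qed.

Lemma continuous_sndT X Y Z (f : X -> Y * Z) :
  continuous f -> continuous (fun x => (f x).2).
Proof. by apply: continuous_compT => x; exact: cvg_snd. Qed.

Lemma continuous_set_val X Y (A : set Y) (f : X -> set_type A) :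
  continuous f -> continuous (fun x => set_val (f x)).
Proof. by apply: continuous_compT; exact: initial_continuous. Qed.

Lemma continuous_set_type X Y (A : set Y) (f : X -> set_type A) :
  continuous (fun x => set_val (f x)) -> continuous f.
Proof. exact: continuous_comp_initial. Qed.

(** Pasting along two closed sets: since [f] and [g] agree where [c = 0], the second branch may be
    extended to the closed set [0 <= c], and the preimage of a closed set is a union of two closed
    sets. *)
Lemma continuous_if_le0 (R : realType) X Y (c : X -> R) (f g : X -> Y) :
  continuous c -> continuous f -> continuous g ->
  (forall x, c x = 0 -> f x = g x) ->
  continuous (fun x => if c x <= 0 then f x else g x).
Proof.
move=> cc cf cg fg; apply/continuous_closedP => B cB.
have -> : (fun x => if c x <= 0 then f x else g x) @^-1` B =
    (c @^-1` [set t | t <= 0] `&` f @^-1` B) `|`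
    (c @^-1` [set t | 0 <= t] `&` g @^-1` B).
  apply/seteqP; split => x /=.
    by case: (leP (c x) 0) => [c0 ?|/ltW c0 ?]; [left|right].
  case=> -[c0 Bx]; first by rewrite c0.
  case: (leP (c x) 0) => // c0'; rewrite fg //.
  by apply/eqP; rewrite eq_le c0 c0'.
move/continuous_closedP in cc; move/continuous_closedP in cf.
move/continuous_closedP in cg.
apply: closedU; apply: closedI; do ?by [apply: cf|apply: cg].
  by apply: cc; exact: closed_le.
by apply: cc; exact: closed_ge.
Qed.

Lemma continuous_addT (R : realType) X (f g : X -> R) :
  continuous f -> continuous g -> continuous (fun x => f x + g x).
Proof. by move=> cf cg x; apply: cvgD; [exact: cf|exact: cg]. Qed.

Lemma continuous_oppT (R : realType) X (f : X -> R) :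
  continuous f -> continuous (fun x => - f x).
Proof. by move=> cf x; apply: cvgN; exact: cf. Qed.

Lemma continuous_mulT (R : realType) X (f g : X -> R) :
  continuous f -> continuous g -> continuous (fun x => f x * g x).
Proof. by move=> cf cg x; apply: cvgM; [exact: cf|exact: cg]. Qed.

Lemma continuous_maxT (R : realType) X (f g : X -> R) :
  continuous f -> continuous g -> continuous (fun x => Order.max (f x) (g x)).
Proof.
by move=> cf cg x; apply: (@continuous_max R X f g); [exact: cf|exact: cg].
Qed.

Lemma continuous_minT (R : realType) X (f g : X -> R) :
  continuous f -> continuous g -> continuous (fun x => Order.min (f x) (g x)).
Proof.
by move=> cf cg x; apply: (@continuous_min R X f g); [exact: cf|exact: cg].
Qed.

End Continuity.

(** * The unit interval and the exponential law for path spaces *)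

Section Clamp.
Variable R : realType.
Local Notation I := (unit_interval R).

Lemma clamp_in_unit (x : R) :
  (`[0, 1]%classic : set R) (Order.max 0 (Order.min 1 x)).
Proof.
rewrite /= in_itv /= le_max lexx /= ge_max ler01 /=.
by rewrite ge_min lexx.
Qed.

(** The retraction of the line onto [I]. It lets homotopies be reparametrized by plain arithmetic,
    values outside [[0, 1]] going to the nearest endpoint. *)
Definition clamp (x : R) : I := sub_elt (clamp_in_unit x).

Lemma set_valI0 : set_val (I0 : I) = 0. Proof. by []. Qed.

Lemma set_valI1 : set_val (I1 : I) = 1. Proof. by []. Qed.

Lemma unit_ge0 (t : I) : 0 <= set_val t.
Proof. by have /= := set_valP t; rewrite in_itv /= => /andP[]. Qed.

Lemma unit_le1 (t : I) : set_val t <= 1.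
Proof. by have /= := set_valP t; rewrite in_itv /= => /andP[]. Qed.

Lemma set_val_clamp x : 0 <= x <= 1 -> set_val (clamp x) = x.
Proof.
by move=> /andP[x0 x1]; rewrite -[LHS]/(Order.max 0 (Order.min 1 x)) min_r ?max_r.
Qed.

Lemma clampK : cancel set_val clamp.
Proof.
move=> t; apply: val_inj; rewrite -[LHS]/(set_val (clamp _)) set_val_clamp //.
by rewrite unit_ge0 unit_le1.
Qed.

Lemma clamp_le0 x : x <= 0 -> clamp x = I0.
Proof.
move=> x0; apply: val_inj => /=; rewrite max_l // ge_min x0 orbT //.
Qed.

Lemma clamp_ge1 x : 1 <= x -> clamp x = I1.
Proof. by move=> x1; apply: val_inj => /=; rewrite min_l // max_r. Qed.

Lemma continuous_clamp (X : topologicalType) (f : X -> R) :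
  continuous f -> continuous (fun x => clamp (f x)).
Proof.
move=> cf; apply: continuous_set_type; apply: continuous_maxT.
  exact: continuous_cstT.
by apply: continuous_minT => //; exact: continuous_cstT.
Qed.

Lemma unit_interval_hausdorff : hausdorff_space I.
Proof.
move=> s t st; apply: val_inj; apply: (@Rhausdorff R) => A B sA tB.
have [z [Az Bz]] := st _ _ (initial_continuous sA) (initial_continuous tB).
by exists (set_val z).
Qed.

Lemma unit_interval_compact : compact [set: I].
Proof.
have -> : [set: I] = clamp @` (`[0, 1] : set R).
  apply/seteqP; split => // t _; exists (set_val t); last exact: clampK.
  exact: (set_valP t).
apply: continuous_compact; last exact: segment_compact.
by apply: continuous_subspaceT; apply: continuous_clamp => x; exact: cvg_id.
Qed.

(** [I] is compact Hausdorff, hence locally compact and regular, and this makes evaluation jointly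
    continuous for the compact-open topology. *)
Lemma continuous_eval (X S : topologicalType) (F : X -> pathspace R S)
    (u : X -> I) :
  continuous F -> continuous u -> continuous (fun x => F x (u x)).
Proof.
move=> cF cu.
have lc : locally_compact [set: I].
  move=> t _; exists setT; first exact: filterT.
  by split; [exact: unit_interval_compact|exact: closedT].
have reg : @regular_space I.
  move=> t; apply: (compact_regular unit_interval_hausdorff).
    exact: unit_interval_compact.
  exact: filterT.
exact: (continuous_compT (@eval_continuous I S lc reg) (continuous_pairT cF cu)).
Qed.

Definition mk_path (S : topologicalType) (p : I -> S) (cp : continuous p) :
    pathspace R S :=
  HB.pack_for (pathspace R S) p (isContinuous.Build _ _ p cp).

(** The converse half of the exponential law: currying a jointly continuous map, then restricting
    the target to continuous functions. *)
Lemma continuous_pathspace (X S : topologicalType) (F : X -> pathspace R S) :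
  continuous (fun z : X * I => F z.1 z.2) -> continuous F.
Proof.
by move=> cF; apply: continuous_comp_initial; exact: continuous_curry_fun cF.
Qed.

End Clamp.

(** Syntax-directed decomposition; continuity of named maps comes from the context. Evaluation of a
    varying path at a varying time is left to [continuous_eval]. *)
Ltac continuity := repeat match goal with
  | H : forall y, continuous_at y ?f |- forall y, continuous_at y ?f => exact H
  | |- forall y, continuous_at y (fun x => x) => exact: continuous_idT
  | |- forall y, continuous_at y fst => exact: (continuous_fstT (@continuous_idT _))
  | |- forall y, continuous_at y snd => exact: (continuous_sndT (@continuous_idT _))
  | |- forall y, continuous_at y set_val => exact: initial_continuous
  | |- forall y, continuous_at y (fun _ => ?c) => exact: continuous_cstT
  | |- forall y, continuous_at y (fun x => (_, _)) => apply: continuous_pairT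
  | |- forall y, continuous_at y (fun x => fst (@?f x)) =>
      apply: (@continuous_fstT _ _ _ f)
  | |- forall y, continuous_at y (fun x => snd (@?f x)) =>
      apply: (@continuous_sndT _ _ _ f)
  | |- forall y, continuous_at y (fun x => set_val (@?f x)) =>
      apply: (@continuous_set_val _ _ _ f)
  | |- forall y, continuous_at y (fun x => clamp (@?f x)) =>
      apply: (@continuous_clamp _ _ f)
  | |- forall y, continuous_at y (fun x => @?f x + @?g x) =>
      apply: (@continuous_addT _ _ f g)
  | |- forall y, continuous_at y (fun x => - @?f x) =>
      apply: (@continuous_oppT _ _ f)
  | |- forall y, continuous_at y (fun x => @?f x * @?g x) =>
      apply: (@continuous_mulT _ _ f g)
  | |- forall y, continuous_at y (fun x => Order.max (@?f x) (@?g x)) =>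
      apply: (@continuous_maxT _ _ f g)
  | H : forall y, continuous_at y ?h
      |- forall y, continuous_at y (fun x => ?h (@?f x)) =>
      apply: (@continuous_compT _ _ _ h f H)
  end.

(** * Homotopies, plain and vertical *)

Section HomotopyOver.
Variable R : realType.
Local Notation I := (unit_interval R).
Implicit Types (X Y E : topologicalType) (B : Type).

(** [B] is a bare type and [p] any function, so a constant [p] gives plain homotopy and each law is
    proved once for both notions. At time 1 the last clause yields [p (g x) = p (f x)]. *)
Definition homotopic_over X E B (p : E -> B) (f g : X -> E) : Prop :=
  exists H : X * I -> E,
    [/\ continuous H, forall x, H (x, I0) = f x, forall x, H (x, I1) = g x &
        forall x t, p (H (x, t)) = p (f x)].

Lemma homotopic_overP X E (f g : X -> E) :
  homotopic R f g <-> homotopic_over (fun=> tt) f g.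
Proof. by split=> -[H]; [case=> *; exists H|case=> *; exists H]. Qed.

Lemma homotopic_over_sym X E B (p : E -> B) (f g : X -> E) :
  homotopic_over p f g -> homotopic_over p g f.
Proof.
case=> H [cH H0 H1 pH]; exists (fun z => H (z.1, clamp (1 - set_val z.2))).
split=> [|x|x|x t] /=; first by continuity.
- by rewrite clamp_ge1 ?H1 // subr0.
- by rewrite clamp_le0 ?H0 // subrr.
- by rewrite -H1 !pH.
Qed.

Lemma homotopic_over_trans X E B (p : E -> B) (f g h : X -> E) :
  homotopic_over p f g -> homotopic_over p g h -> homotopic_over p f h.
Proof.
case=> H [cH H0 H1 pH] [K [cK K0 K1 pK]].
exists (fun z => if 2 * set_val z.2 - 1 <= 0 then H (z.1, clamp (2 * set_val z.2))
  else K (z.1, clamp (2 * set_val z.2 - 1))); split=> [|x|x|x t] /=.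
- apply: continuous_if_le0; [by continuity..|] => -[x t] /= t2.
  by rewrite clamp_ge1 ?H1 ?clamp_le0 ?K0 //; lra.
- by rewrite set_valI0 mulr0 sub0r lerN10 clamp_le0 ?H0.
- by rewrite set_valI1 ifF ?clamp_ge1 ?K1 //; lra.
- by case: ifP => _; rewrite ?pK -?H1 pH.
Qed.

Lemma homotopic_over_postcomp X E E' B B' (p : E -> B) (p' : E' -> B')
    (f g : X -> E) (u : E -> E') :
  continuous u -> (forall x y, p x = p y -> p' (u x) = p' (u y)) ->
  homotopic_over p f g -> homotopic_over p' (u \o f) (u \o g).
Proof.
move=> cu pu [H [cH H0 H1 pH]]; exists (fun z => u (H z)).
split=> [|x|x|x t] /=; first by continuity.
- by rewrite H0.
- by rewrite H1.
- exact/pu/pH.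
Qed.

Lemma homotopic_over_precomp X Y E B (p : E -> B) (f g : X -> E) (u : Y -> X) :
  continuous u -> homotopic_over p f g -> homotopic_over p (f \o u) (g \o u).
Proof.
move=> cu [H [cH H0 H1 pH]]; exists (fun z => H (u z.1, z.2)).
by split=> /=[|x|x|x t]; first by continuity.
Qed.

Lemma homotopic_sym X E (f g : X -> E) : homotopic R f g -> homotopic R g f.
Proof.
move=> /homotopic_overP fg; apply/homotopic_overP.
exact: homotopic_over_sym fg.
Qed.

Lemma homotopic_trans X E (f g h : X -> E) :
  homotopic R f g -> homotopic R g h -> homotopic R f h.
Proof.
move=> /homotopic_overP fg /homotopic_overP gh.
apply/homotopic_overP; exact: homotopic_over_trans fg gh.
Qed.

Lemma homotopic_postcomp X E (E' : topologicalType) (f g : X -> E) (u : E -> E') :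
  continuous u -> homotopic R f g -> homotopic R (u \o f) (u \o g).
Proof.
move=> cu /homotopic_overP fg; apply/homotopic_overP.
exact: homotopic_over_postcomp fg.
Qed.

Lemma homotopic_precomp X Y E (f g : X -> E) (u : Y -> X) :
  continuous u -> homotopic R f g -> homotopic R (f \o u) (g \o u).
Proof.
move=> cu /homotopic_overP fg; apply/homotopic_overP.
exact: homotopic_over_precomp fg.
Qed.

Lemma homotopic_over_homotopic X E B (p : E -> B) (f g : X -> E) :
  homotopic_over p f g -> homotopic R f g.
Proof. by case=> H [cH H0 H1 _]; exists H. Qed.

End HomotopyOver.

(** * Dold's theorem on homotopy equivalences over a base *)

Section Dold.
Variable R : realType.
Local Notation I := (unit_interval R).

(** Lifting for all test spaces [X], without a separation condition; it is applied below to total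
    spaces and their products with [I]. *)
Definition homotopy_lifting (E B : topologicalType) (p : E -> B) : Prop :=
  forall (X : topologicalType) (h : X -> E) (H : X * I -> B),
    continuous h -> continuous H -> (forall x, H (x, I0) = p (h x)) ->
    exists K : X * I -> E,
      [/\ continuous K, forall x, K (x, I0) = h x & forall z, p (K z) = H z].

(** Turns a triangle commuting up to homotopy into a strictly commuting one: [g] is the end of a
    lift, started at [f], of the homotopy downstairs. *)
Lemma lift_homotopic (X E B : topologicalType) (p : E -> B) (f : X -> E)
    (q : X -> B) :
  homotopy_lifting p -> continuous f -> homotopic R (p \o f) q ->
  exists2 g : X -> E, homotopic R f g & p \o g = q.
Proof.
move=> hp cf [H [cH H0 H1]]; have [K [cK K0 pK]] := hp _ _ _ cf cH H0.
exists (fun x => K (x, I1)); first by exists K.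
by apply/funext => x /=; rewrite pK H1.
Qed.

Lemma homotopic_continuousr (X Y : topologicalType) (f g : X -> Y) :
  homotopic R f g -> continuous g.
Proof.
case=> H [cH _ /funext <-]; by continuity.
Qed.

(* [J] joins [h \o k] to the identity, and [p \o J] runs through the homotopy
   [A] backwards and then forwards.  [M] contracts [p \o J] rel endpoints; a lift
   [N] of [M] starting at [J] is vertical on the other three sides of the
   square. *)
Lemma fiberwise_right_inverse (E B : topologicalType) (p : E -> B) (h : E -> E) :
  continuous p -> homotopy_lifting p -> continuous h -> p \o h = p ->
  homotopic R h idfun ->
  exists k : E -> E,
    [/\ continuous k, p \o k = p & homotopic_over R p (h \o k) idfun].
Proof.
move=> cp hp ch ph [H [cH H0 H1]].
pose A (z : E * I) := p (H (z.1, z.2)).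
have cA : continuous A by rewrite /A; continuity.
have A0 x : A (x, I0) = p x by rewrite /A /= H0 -[LHS]/((p \o h) x) ph.
have A1 x : A (x, I1) = p x by rewrite /A /= H1.
(* [A] is a loop of maps at [p], because [p \o h = p]. Lifting it from the identity makes the end
   [K (-, I1)], the future [k], a map over [B]. *)
have [K [cK K0 pK]] := hp _ _ _ (@continuous_idT E) cA A0.
have phE y : p (h y) = p y by rewrite -[LHS]/((p \o h) y) ph.
(* [phi s] is |2s - 1|, the time of [A] over which [J (x, s)] lies. In [M] it is raised to max(phi
   s, t): all times reach 1 at t = 1, and s = 0, 1 stay put because [phi] is already 1 there. *)
pose phi (s : R) : R := Order.max (1 - 2 * s) (2 * s - 1).
pose J (z : E * I) := let s := set_val z.2 in
  if 2 * s - 1 <= 0 then h (K (z.1, clamp (1 - 2 * s)))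
  else H (z.1, clamp (2 * s - 1)).
have cJ : continuous J.
  apply: continuous_if_le0; [by continuity..|] => -[x t] /= t2.
  by rewrite !clamp_le0 ?K0 ?H0 //; lra.
pose M (z : (E * I) * I) :=
  A (z.1.1, clamp (Order.max (phi (set_val z.1.2)) (set_val z.2))).
have cM : continuous M by rewrite /M /phi; continuity.
have M0 z : M (z, I0) = p (J z).
  rewrite /M /J /phi set_valI0; case: z => x t /=; case: leP => t2.
    rewrite phE pK; congr (A (_, clamp _)).
    by rewrite !max_l //; rewrite ?max_l; lra.
  rewrite -[RHS]/(A (x, _)); congr (A (_, clamp _)).
  by rewrite max_l max_r //; lra.
have [N [cN N0 pN]] := hp _ _ _ cJ cM M0.
exists (fun x => K (x, I1)); split; first by continuity.
  by apply/funext => x /=; rewrite pK A1.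
have M1 x s : M (x, s, I1) = p x.
  by rewrite /M /= clamp_ge1 ?A1 // le_max lexx orbT.
have Mend x s t : s = I0 \/ s = I1 -> M (x, s, t) = p x.
  move=> s01; rewrite /M /phi /= clamp_ge1 ?A1 //.
  rewrite !le_max; case: s01 => ->; rewrite ?set_valI0 ?set_valI1; lra.
have JI0 x : J (x, I0) = h (K (x, I1)).
  by rewrite /J /= set_valI0 mulr0 sub0r lerN10 clamp_ge1 // subr0.
have JI1 x : J (x, I1) = x.
  by rewrite /J /= set_valI1 ifF ?clamp_ge1 ?H1 //; lra.
have pk x : p (h (K (x, I1))) = p x by rewrite phE pK A1.
have c1 : homotopic_over R p (h \o (fun x => K (x, I1))) (fun x => N (x, I0, I1)).
  exists (fun z => N (z.1, I0, z.2)); split=> [|x|x|x t] //=.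
  - by continuity.
  - by rewrite N0 JI0.
  - by rewrite pN Mend ?pk //; left.
have c2 : homotopic_over R p (fun x => N (x, I0, I1)) (fun x => N (x, I1, I1)).
  exists (fun z => N (z.1, z.2, I1)); split=> [|x|x|x t] //=.
  - by continuity.
  - by rewrite !pN !M1.
have c3 : homotopic_over R p idfun (fun x => N (x, I1, I1)).
  exists (fun z => N (z.1, I1, z.2)); split=> [|x|x|x t] //=.
  - by continuity.
  - by rewrite N0 JI1.
  - by rewrite pN Mend //; right.
exact: homotopic_over_trans c1 (homotopic_over_trans c2 (homotopic_over_sym c3)).
Qed.

(** First [u] and [v] are deformed to maps [u1], [v1] strictly over [B]. Then [u1] gets a vertical
    right inverse [w], and [w \o u1] gets one as well; as in a group, a right inverse that itself
    has a right inverse is two-sided. *)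
Lemma dold (E1 E2 B : topologicalType) (p1 : E1 -> B) (p2 : E2 -> B)
    (u : E1 -> E2) (v : E2 -> E1) :
  continuous p1 -> continuous p2 ->
  homotopy_lifting p1 -> homotopy_lifting p2 ->
  homotopy_inverse R u v -> homotopic R (p2 \o u) p1 ->
  fiber_homotopy_equivalent R p1 p2.
Proof.
move=> cp1 cp2 hp1 hp2 [cu cv vu uv] p2u.
have [u1 uu1 p2u1] := lift_homotopic hp2 cu p2u.
have cu1 := homotopic_continuousr uu1.
have vu1 : homotopic R (v \o u1) idfun.
  exact: homotopic_trans (homotopic_postcomp cv (homotopic_sym uu1)) vu.
have u1v : homotopic R (u1 \o v) idfun.
  exact: homotopic_trans (homotopic_precomp cv (homotopic_sym uu1)) uv.
have p1v : homotopic R (p1 \o v) p2.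
  by rewrite -p2u1; exact: (homotopic_postcomp cp2 u1v).
have [v1 vv1 p1v1] := lift_homotopic hp1 cv p1v.
have cv1 := homotopic_continuousr vv1.
have v1u1 : homotopic R (v1 \o u1) idfun.
  exact: homotopic_trans (homotopic_precomp cu1 (homotopic_sym vv1)) vu1.
have u1v1 : homotopic R (u1 \o v1) idfun.
  exact: homotopic_trans (homotopic_postcomp cu1 (homotopic_sym vv1)) u1v.
have [||k [ck p2k u1v1k]] := fiberwise_right_inverse cp2 hp2 _ _ u1v1.
- exact: continuous_compT.
- by rewrite compA p2u1.
pose w := v1 \o k.
have cw : continuous w by exact: continuous_compT.
have p1w : p1 \o w = p2 by rewrite /w compA p1v1.
(* [w] is homotopic to [v1 \o u1 \o w], which is [v1] after [u1 \o v1 \o k], hence homotopic to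
   [v1]. *)
have wv1 : homotopic R w v1.
  have := homotopic_precomp cw (homotopic_sym v1u1) => /homotopic_trans; apply.
  exact: (homotopic_postcomp cv1 (homotopic_over_homotopic u1v1k)).
have wu1 : homotopic R (w \o u1) idfun.
  exact: homotopic_trans (homotopic_precomp cu1 wv1) v1u1.
have [||k' [ck' p1k' wu1k']] := fiberwise_right_inverse cp1 hp1 _ _ wu1.
- exact: continuous_compT.
- by rewrite compA p1w.
have w_over x y : p2 x = p2 y -> p1 (w x) = p1 (w y).
  by rewrite -[p1 (w x)]/((p1 \o w) x) -[p1 (w y)]/((p1 \o w) y) p1w.
have p2u1E x : p2 (u1 x) = p1 x by rewrite -p2u1.
have p1wE y : p1 (w y) = p2 y by rewrite -p1w.
(* Vertically, w u1 ~ w u1 (w u1 k') = w (u1 w) u1 k' ~ w u1 k' ~ id. *)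
have wu1_over : homotopic_over R p1 (w \o u1) idfun.
  have wu1_expand := homotopic_over_postcomp (p' := p1) (u := w \o u1)
    (continuous_compT cw cu1) _ (homotopic_over_sym wu1k').
  have := homotopic_over_postcomp (p' := p1) cw w_over
    (homotopic_over_precomp (continuous_compT cu1 ck') u1v1k).
  move=> /homotopic_over_trans /(_ wu1k'); apply: homotopic_over_trans.
  by apply: wu1_expand => x y; rewrite /= !p1wE !p2u1E.
exists u1, w; split=> //.
- by case: wu1_over => H [cH H0 H1 pH]; exists H; split=> // x t;
    rewrite pH /= p1wE p2u1E.
- by case: u1v1k => H [cH H0 H1 pH]; exists H; split=> // x t;
    rewrite pH -[LHS]/(p2 (u1 (w x))) p2u1E p1wE.
Qed.

End Dold.

(** * Homotopy lifting for the endpoint projection of paths *)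

Section SigmaFibration.
Variable R : realType.
Local Notation I := (unit_interval R).

Lemma continuous_const_time (X S : topologicalType) (F : X -> pathspace R S)
    (t : I) :
  continuous F -> continuous (fun x => F x t).
Proof. by move=> cF; apply: continuous_eval => //; exact: continuous_cstT. Qed.

Lemma Sigma_proj_continuous (S : topologicalType) (A : set S) :
  continuous (@Sigma_proj R S A).
Proof.
have cv : continuous (@set_val _ (@Sigma_space R S A)) by exact: initial_continuous.
by apply: continuous_pairT; apply: continuous_set_type;
  exact: continuous_const_time.
Qed.

Lemma Sigma_proj_lifting (S : topologicalType) (A : set S) :
  homotopy_lifting R (@Sigma_proj R S A).
Proof.
move=> X h H ch cH H0.
pose hv x : pathspace R S := set_val (h x).
have chv : continuous hv by apply: continuous_set_val.
have H01 x : set_val (H (x, I0)).1 = hv x I0 by rewrite H0.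
have H02 x : set_val (H (x, I0)).2 = hv x I1 by rewrite H0.
(* [r] runs from [- t] to [1 + t] as [s] runs over [[0, 1]]: the path [h x],
   preceded by [H (x, -).1] reversed and followed by [H (x, -).2]. *)
pose r (t s : I) : R := set_val s * (1 + 2 * set_val t) - set_val t.
pose k (z : (X * I) * I) : S :=
  let: u := r z.1.2 z.2 in
  if u <= 0 then set_val (H (z.1.1, clamp (- u))).1
  else if u - 1 <= 0 then hv z.1.1 (clamp u)
  else set_val (H (z.1.1, clamp (u - 1))).2.
have ck : continuous k.
  have cr : continuous (fun z : (X * I) * I => r z.1.2 z.2).
    by rewrite /r; continuity.
  rewrite /k; apply: continuous_if_le0 => //.
  - by continuity.
  - apply: continuous_if_le0.
    + by continuity.
    + by apply: continuous_eval; continuity.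
    + by continuity.
    + move=> z /= u1; rewrite u1 [clamp 0]clamp_le0 // H02 clamp_ge1 //; lra.
  - move=> z /= u0; by rewrite u0 oppr0 sub0r lerN10 clamp_le0.
have ckz z : continuous (fun s => k (z, s)) by continuity.
pose K z := mk_path (ckz z).
have r0 t : r t I0 = - set_val t by rewrite /r set_valI0; lra.
have r1 t : r t I1 = 1 + set_val t by rewrite /r set_valI1; lra.
have K0 z : K z I0 = set_val (H z).1.
  rewrite -[LHS]/(k (z, I0)) /k /= r0 oppr_le0 unit_ge0 opprK clampK.
  by case: z.
have K1 z : K z I1 = set_val (H z).2.
  rewrite -[LHS]/(k (z, I1)) /k /= r1; case: z => x t /=.
  have t0 := unit_ge0 t; rewrite ifF; last lra.
  have -> : 1 + set_val t - 1 = set_val t by lra.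
  (* Only t = 0 falls into the middle branch; there [H02] identifies the end of the path [h x] with
     the value of [H]. *)
  case: leP => t0'; last by rewrite clampK.
  have -> : t = I0 by apply: val_inj; apply/eqP; rewrite eq_le t0 t0'.
  by rewrite set_valI0 addr0 clamp_ge1.
have KA z : @Sigma_space R S A (K z).
  by split; [rewrite K0|rewrite K1]; exact: set_valP.
exists (fun z => sub_elt (KA z)); split.
- by apply: continuous_set_type; apply: continuous_pathspace; exact: ck.
- move=> x; apply: val_inj; apply/continuousEP => s /=.
  have rI : r I0 s = set_val s by rewrite /r set_valI0; lra.
  have [s0 s1] := (unit_ge0 s, unit_le1 s).
  rewrite -[LHS]/(k (x, I0, s)) /k /= rI; case: leP => s0'.
    have -> : s = I0 by apply: val_inj; apply/eqP; rewrite eq_le s0 s0'.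
    by rewrite set_valI0 oppr0 clamp_le0 ?H01.
  by rewrite ifT ?clampK //; lra.
- move=> z; rewrite /Sigma_proj [RHS]surjective_pairing.
  by congr (_, _); [apply: val_inj; exact: K0|apply: val_inj; exact: K1].
Qed.

(** The homotopy is moved back along the inverse of [u] and lifted through [p]. This serves both the
    identification of the fibers with [F] and the twist by [g x g]. *)
Lemma rebase_lifting (E B B' : topologicalType) (p : E -> B)
    (u : homeomorphism B B') :
  homotopy_lifting R p -> homotopy_lifting R (rebase p u).
Proof.
move=> hp X h H ch cH H0.
have cuH : continuous (fun z => homeo_inv u (H z)).
  by apply: continuous_compT => //; exact: homeo_inv_continuous.
have uH0 x : homeo_inv u (H (x, I0)) = p (h x).
  by rewrite H0 /rebase /= homeo_funK.
have [K [cK K0 pK]] := hp X h _ ch cuH uH0.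
by exists K; split=> // z; rewrite /rebase /= pK homeo_invK.
Qed.

End SigmaFibration.

(** * The homotopy equivalence between loops times fiber and the total space of Sigma(f) *)

Section LoopsTimesFiber.
Variables (R : realType) (S O F : topologicalType).
Variables (f : continuousType S O) (o : O).
Variables (j : homeomorphism F (set_type (fiber f o))) (L : lifting_function R f).
Local Notation I := (unit_interval R).
Local Notation Sigma := (set_type (@Sigma_space R S (fiber f o))).

Lemma map_path_loop (a : Sigma) : loops R o (Defs.map_path f (set_val a)).
Proof. by have [] := set_valP a. Qed.

Definition pull (a : Sigma) : set_type (loops R o) * F :=
  (sub_elt (map_path_loop a), homeo_inv j (Sigma_proj a).1).

Lemma lift_loop_Sigma (z : set_type (loops R o) * F) :
  @Sigma_space R S (fiber f o) (L (mk_triangle (loop_triangle z.1 (j z.2)))).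
Proof.
by split; [rewrite lift_start; exact: set_valP|exact: lift_loop_fiber].
Qed.

Definition push (z : set_type (loops R o) * F) : Sigma :=
  sub_elt (lift_loop_Sigma z).

(** A lift starts at the prescribed point and ends, by definition, at the value of the Lf-function;
    this is the link between Theta and Sigma(f). *)
Lemma Sigma_fib_on_push z :
  Sigma_fib_on R j (push z) = (z.2, Lf_function_on j L z).
Proof.
congr (_, _); last by congr homeo_inv; exact: val_inj.
rewrite /= -[RHS](homeo_funK j); congr homeo_inv.
by apply: val_inj => /=; rewrite lift_start.
Qed.

(** A lift of a loop projects back onto it and keeps its starting point, so this composite is the
    identity on the nose; only the other one requires a homotopy. *)
Lemma pushK : cancel push pull.
Proof.
move=> z; rewrite [RHS]surjective_pairing; congr (_, _).
  by apply: val_inj; rewrite /= lift_over.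
by have /(congr1 fst) := Sigma_fib_on_push z.
Qed.

Lemma pull_continuous : continuous pull.
Proof.
apply: continuous_pairT.
  apply: continuous_set_type; apply: continuous_pathspace => /=.
  apply: continuous_compT; first exact: cts_fun.
  apply: continuous_eval; last by continuity.
  by continuity.
apply: continuous_compT; first exact: homeo_inv_continuous.
by apply: continuous_fstT; exact: Sigma_proj_continuous.
Qed.

Lemma push_continuous : continuous push.
Proof.
apply: continuous_set_type => /=.
apply: (continuous_compT (@lift_continuous _ _ _ _ L)).
apply: continuous_set_type => /=; apply: continuous_pairT.
  by have cj := @homeo_fun_continuous _ _ j; continuity.
by continuity.
Qed.

(* At time [s], follow [a] up to [a s], then the lift of the rest of [f o a]. *)
Lemma push_pull_homotopic : homotopic R (push \o pull) idfun.
Proof.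
(* The remainder of [f o a] from time s on keeps its original speed and is constant once s + u
   passes 1; hence its lift is read at t - s in [k]. *)
pose rest (z : Sigma * I) (u : I) : O :=
  f (set_val z.1 (clamp (set_val z.2 + set_val u))).
have crest : continuous (fun y => rest y.1 y.2).
  apply: continuous_compT; first exact: cts_fun.
  by apply: continuous_eval; continuity.
have crestz z : continuous (rest z).
  exact: (continuous_compT crest
    (continuous_pairT (@continuous_cstT _ _ z) (@continuous_idT _))).
have rest0 (z : Sigma * I) : f (set_val z.1 z.2) = mk_path (crestz z) I0.
  by rewrite -[RHS]/(rest z I0) /rest set_valI0 addr0 clampK.
pose T (z : Sigma * I) := mk_triangle (rest0 z).
have cT : continuous T.
  apply: continuous_set_type => /=; apply: continuous_pairT.
    by apply: continuous_eval; continuity.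
  by apply: continuous_pathspace; exact: crest.
have cLT : continuous (fun z : Sigma * I => L (T z)).
  exact: (continuous_compT (@lift_continuous _ _ _ _ L) cT).
pose k (y : (Sigma * I) * I) : S :=
  if set_val y.2 - set_val y.1.2 <= 0 then set_val y.1.1 y.2
  else L (T y.1) (clamp (set_val y.2 - set_val y.1.2)).
have ck : continuous k.
  apply: continuous_if_le0.
  - by continuity.
  - by apply: continuous_eval; continuity.
  - apply: continuous_eval; last by continuity.
    by apply: (continuous_compT cLT); continuity.
  - move=> [[a s] t] /= /eqP; rewrite subr_eq0 => /eqP/val_inj ->.
    by rewrite subrr clamp_le0 // lift_start.
have ckz z : continuous (fun t => k (z, t)).
  exact: (continuous_compT ck
    (continuous_pairT (@continuous_cstT _ _ z) (@continuous_idT _))).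
pose K (z : Sigma * I) := mk_path (ckz z).
(* Every stage of the deformation lies over [f o a], so its endpoints stay in the fiber. *)
have fK (z : Sigma * I) t : f (k (z, t)) = f (set_val z.1 t).
  rewrite /k /=; case: leP => // st.
  rewrite -[LHS]/(Defs.map_path f _ _) lift_over.
  have [[s0 _] [_ t1]] := ((unit_ge0 z.2, unit_ge0 t), (unit_le1 z.2, unit_le1 t)).
  rewrite -[LHS]/(rest z (clamp (set_val t - set_val z.2))) /rest.
  rewrite [X in clamp X](_ : _ = set_val t) ?clampK //.
  by rewrite set_val_clamp; lra.
have KA (z : Sigma * I) : @Sigma_space R S (fiber f o) (K z).
  have [a0 a1] := set_valP z.1.
  by split; rewrite /fiber /= -[f _]/(f (k (z, _))) fK.
exists (fun z => sub_elt (KA z)); split.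
- by apply: continuous_set_type; apply: continuous_pathspace; exact: ck.
- move=> a; apply: val_inj; apply/continuousEP => t /=.
  rewrite -[LHS]/(k (a, I0, t)) /k /= subr0 clampK.
  (* At s = 0 the remainder is all of [f o a] and the lift starts at [a I0]: exactly the data lifted
     by [push (pull a)]. *)
  have TE : T (a, I0) = mk_triangle (loop_triangle (pull a).1 (j (pull a).2)).
    apply: val_inj; rewrite /= homeo_invK; congr (_, _).
    apply/continuousEP => u /=; rewrite -[LHS]/(rest (a, I0) u) /rest /=.
    by rewrite set_valI0 add0r clampK.
  rewrite -TE; case: leP => // t0.
  have -> : t = I0 by apply: val_inj; apply/eqP; rewrite eq_le t0 unit_ge0.
  by rewrite lift_start.
- move=> a; apply: val_inj; apply/continuousEP => t /=.
  by rewrite -[LHS]/(k (a, I1, t)) /k /= ifT // subr_le0 unit_le1.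
Qed.

End LoopsTimesFiber.

(** * Comparison of the two total spaces over F x F *)

Theorem theorem5p2 (R : realType) (S1 S2 O F : topologicalType)
  (hausS1 : hausdorff_space S1) (hausS2 : hausdorff_space S2)
  (hausO : hausdorff_space O) (hausF : hausdorff_space F)
  (f1 : continuousType S1 O) (f2 : continuousType S2 O)
  (regf1 : regular_fibration R f1) (regf2 : regular_fibration R f2)
  (L1 : lifting_function R f1) (L2 : lifting_function R f2)
  (regL1 : regular_lifting_function L1) (regL2 : regular_lifting_function L2)
  (ro : O)
  (j1 : homeomorphism F (set_type (fiber f1 ro)))
  (j2 : homeomorphism F (set_type (fiber f2 ro)))
  (so : F)
  (g : homeomorphism F F) (g' : F -> F)
  (g'_inv : homotopy_inverse R g g')
  (conj_g : homotopic R (Lf_function_on j1 L1)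
              (g' \o Lf_function_on j2 L2 \o prod_map idfun g))
  (pcF : path_connected R F) (anrF : is_ANR R F)
  (scS1 : simply_connected R S1) (scS2 : simply_connected R S2)
  (anrOmega : has_ANR_homotopy_type R (set_type (loops R ro))) :
  fiber_homotopy_equivalent R
    (rebase (Sigma_fib_on R j1) (homeo_prod g g))
    (Sigma_fib_on R j2).
Proof.
have cg := @homeo_fun_continuous _ _ g.
have cgi := @homeo_inv_continuous _ _ g.
have [_ _ _ gg'] := g'_inv.
pose p1 := rebase (Sigma_fib_on R j1) (homeo_prod g g).
pose p2 := Sigma_fib_on R j2.
have cp (S : topologicalType) (f : continuousType S O)
    (j : homeomorphism F (set_type (fiber f ro))) :
    continuous (Sigma_fib_on R j).
  by apply: continuous_compT (@homeo_fun_continuous _ _ _)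
    (@Sigma_proj_continuous _ _ _).
have hp (S : topologicalType) (f : continuousType S O)
    (j : homeomorphism F (set_type (fiber f ro))) :
    homotopy_lifting R (Sigma_fib_on R j).
  by apply: rebase_lifting; exact: Sigma_proj_lifting.
have cp1 : continuous p1.
  exact: continuous_compT (@homeo_fun_continuous _ _ (homeo_prod g g)) (cp _ _ j1).
pose idg : set_type (loops R ro) * F -> _ := prod_map idfun g.
pose idgi : set_type (loops R ro) * F -> _ := prod_map idfun (homeo_inv g).
have cidg : continuous idg by apply: prod_map_continuous => //; exact: continuous_idT.
have cidgi : continuous idgi by apply: prod_map_continuous => //; exact: continuous_idT.
have idgK : cancel idg idgi by apply: prod_map_cancel => //; exact: homeo_funK.
have idgiK : cancel idgi idg by apply: prod_map_cancel => //; exact: homeo_invK.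
have [cpull1 cpull2] := (@pull_continuous R _ _ _ _ _ j1,
  @pull_continuous R _ _ _ _ _ j2).
have [cpush1 cpush2] := (push_continuous (j := j1) (L := L1),
  push_continuous (j := j2) (L := L2)).
have [h1 h2] := (push_pull_homotopic j1 L1, push_pull_homotopic j2 L2).
pose u := push j2 L2 \o idg \o pull j1.
pose v := push j1 L1 \o idgi \o pull j2.
have uv : homotopy_inverse R u v.
  split; rewrite /u /v /comp.
  - by continuity.
  - by continuity.
  (* The inner pull-push pair and [g] with its inverse cancel strictly, leaving a composite already
     known to be homotopic to the identity. *)
  - rewrite (_ : (fun x => _) = push j1 L1 \o pull j1) //.
    by apply/funext => x /=; rewrite pushK idgK.
  - rewrite (_ : (fun x => _) = push j2 L2 \o pull j2) //.
    by apply/funext => x /=; rewrite pushK idgiK.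
have hp1 : homotopy_lifting R p1 by apply: rebase_lifting; exact: hp.
apply: (dold cp1 (cp _ _ j2) hp1 (hp _ _ j2) uv).
(* Replacing [p1] by [p1 \o push \o pull] makes both sides factor through [pull j1]. It remains to
   compare (g x, g Theta1(w, x)) with (g x, Theta2(w, g x)). *)
have p1h : homotopic R (p1 \o push j1 L1 \o pull j1) p1.
  exact: (homotopic_postcomp cp1 h1).
apply: homotopic_trans p1h.
have -> : p1 \o push j1 L1 \o pull j1 =
    (fun z => (g z.2, (g \o Lf_function_on j1 L1) z)) \o pull j1.
  by apply/funext => a; rewrite /p1 /rebase /= Sigma_fib_on_push.
have -> : p2 \o u =
    (fun z => (g z.2, (Lf_function_on j2 L2 \o idg) z)) \o pull j1.
  by apply/funext => a; rewrite /p2 /u /= Sigma_fib_on_push.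
apply: homotopic_precomp => //.
(* Conjugacy composed with [g] gives g Theta1 ~ g g' Theta2 (id x g), and g g' ~ id removes the
   prefix. *)
have gTheta : homotopic R (Lf_function_on j2 L2 \o idg) (g \o Lf_function_on j1 L1).
  apply: homotopic_sym; apply: homotopic_trans (homotopic_postcomp cg conj_g) _.
  apply: (homotopic_precomp (f := g \o g') (g := idfun)
    (u := Lf_function_on j2 L2 \o idg)) => //.
  apply: (continuous_compT _ cidg).
  (* Continuity of Theta2 is read off from its description as the second coordinate of Sigma(f2)
     after [push]. *)
  have -> : Lf_function_on j2 L2 = (fun z => (Sigma_fib_on R j2 (push j2 L2 z)).2).
    by apply/funext => z; rewrite Sigma_fib_on_push.
  by have cSigma2 := cp _ _ j2; continuity.
have [H [cH H0 H1]] := gTheta.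
exists (fun z => (g z.1.2, H z)); split; first by continuity.
- by move=> z; rewrite H0.
- by move=> z; rewrite H1.
Qed.
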